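(* Suppose $\mathbb K$ is a computable age with the hereditary property (HP). Then $\mathbb K$ has the $\mathscr{EI}(\mathbb K)$-computable hereditary property; that is, there is a function, computable from the embedding information $\mathscr{EI}(\mathbb K)$, that takes each pair $(\mathbb I(i),\mathbf b)$ with $\mathbf b\in\mathcal A_i$ a finite tuple and returns some $\mathbb I(j)$ such that $\mathbf a_j\simeq\mathbf b$.
   Context: Languages and structures. $\mathcal{L}$ is a countable language (relation symbols of positive arity; function symbols of any arity, 0-ary ones being constants) with a computable representation: relation symbols $R_n$ and function symbols $F_m$ are indexed bijectively by disjoint computable subsets of $\omega$, with arity computable from the index. An $\mathcal{L}$-structure $\mathcal{M}$ is c.e. if its underlying set $M$ is a c.e. subset of $\omega$ and the sets $\{(n,\mathbf a): \mathcal M\models R_n(\mathbf a)\}$, $\{(n,\mathbf a): \mathcal M\models \neg R_n(\mathbf a)\}$, $\{(m,\mathbf a,b): \mathcal M\models F_m(\mathbf a)=b\}$ are c.e.; it is computable if moreover $M$ is computable. Tuples are finite; $\mathrm{cl}_{\mathcal M}(\mathbf a)$ is the smallest substructure of $\mathcal M$ containing $\mathbf a$. For $\mathbf a\in\mathcal A$, $\mathbf b\in\mathcal B$ of the same length, $\mathbf a\simeq\mathbf b$ means that for every atomic $\mathcal L$-formula $\varphi$, $\mathcal A\models\varphi(\mathbf a)$ iff $\mathcal B\models\varphi(\mathbf b)$; equivalently $\mathbf a\mapsto\mathbf b$ extends to an isomorphism $\mathrm{cl}(\mathbf a)\to\mathrm{cl}(\mathbf b)$. Ages. An age is a collection of finitely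 generated $\mathcal L$-structures closed under isomorphism. A computable age (computable representation of an age $\mathcal K$) is a c.e. set $\mathbb K$ of triples $(\mathbf a,\mathcal A,i)$ (computable structures being given by indices), with exactly one triple for each $i\in\omega$, written $\mathbb I(i)=(\mathbf a_i,\mathcal A_i,i)$, such that each $\mathcal A_i$ is a computable $\mathcal L$-structure in $\mathcal K$ with $\mathcal A_i=\mathrm{cl}_{\mathcal A_i}(\mathbf a_i)$, and every $\mathcal B\in\mathcal K$ is isomorphic to some $\mathcal A_i$. $\mathbb K$ is said to have a property of ages if $\mathcal K$ does. The embedding information $\mathscr{EI}(\mathbb K)$ is the set of tuples $(\mathbb I(k_0),\mathbf b_0,\mathbb I(k_1),\mathbf b_1)$ with $\mathbf b_0\in\mathcal A_{k_0}$, $\mathbf b_1\in\mathcal A_{k_1}$ and $\mathbf b_0\simeq\mathbf b_1$. (HP): for all $\mathcal B\in\mathcal K$, $\mathcal A\subseteq\mathcal B$ implies $\mathcal A\in\mathcal K$.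
   Formalization: A computable age is required to represent every B in K together with every generating tuple b: some isomorphism from B to some A_i sends b to a_i. With only ''B is isomorphic to some A_i'' the claim fails, since no a_j need have the length of b. *)

(* Defs.v *)
From Stdlib Require Cantor.
From mathcomp Require Import all_boot.

Set Implicit Arguments.
Unset Strict Implicit.
Unset Printing Implicit Defensive.

Definition cpair (x y : nat) : nat := Cantor.to_nat (x, y).
Definition cfst (z : nat) : nat := (Cantor.of_nat z).1.
Definition csnd (z : nat) : nat := (Cantor.of_nat z).2.

(* Unary partial recursive functions with an oracle.  Arguments are packed by
   the (computable) Cantor bijection, so that Pair, Fst and Snd replace the
   projections of the n-ary presentation. *)
Inductive prog : Type :=
| Zero
| Succ
| Fst
| Snd
| Oracle
| Pair of prog & prog
| Comp of prog & prog
| PrimRec of prog & prog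
| Mu of prog.

(* [eval O p x y]: p with oracle O converges on x with value y. *)
Inductive eval (O : nat -> Prop) : prog -> nat -> nat -> Prop :=
| eval_zero x : eval O Zero x 0
| eval_succ x : eval O Succ x x.+1
| eval_fst x : eval O Fst x (cfst x)
| eval_snd x : eval O Snd x (csnd x)
| eval_oracle_in x : O x -> eval O Oracle x 1
| eval_oracle_out x : ~ O x -> eval O Oracle x 0
| eval_pair p q x y z :
    eval O p x y -> eval O q x z -> eval O (Pair p q) x (cpair y z)
| eval_comp p q x y z :
    eval O q x y -> eval O p y z -> eval O (Comp p q) x z
| eval_rec0 p q x y :
    eval O p x y -> eval O (PrimRec p q) (cpair x 0) y
| eval_recS p q x n y z :
    eval O (PrimRec p q) (cpair x n) y ->
    eval O q (cpair x (cpair n y)) z ->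
    eval O (PrimRec p q) (cpair x n.+1) z
| eval_mu p x n :
    eval O p (cpair x n) 0 ->
    (forall m, m < n -> exists y, eval O p (cpair x m) y.+1) ->
    eval O (Mu p) x n.

Definition no_oracle (_ : nat) : Prop := False.

(* Goedel numbering; it is injective with computable range. *)
Fixpoint prog_code (p : prog) : nat :=
  match p with
  | Zero => cpair 0 0
  | Succ => cpair 1 0
  | Fst => cpair 2 0
  | Snd => cpair 3 0
  | Oracle => cpair 4 0
  | Pair p q => cpair 5 (cpair (prog_code p) (prog_code q))
  | Comp p q => cpair 6 (cpair (prog_code p) (prog_code q))
  | PrimRec p q => cpair 7 (cpair (prog_code p) (prog_code q))
  | Mu p => cpair 8 (prog_code p)
  end.

(* Numbers that code no program are indices of the nowhere defined function. *)
Definition phi (e x y : nat) : Prop :=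
  exists2 p, prog_code p = e & eval no_oracle p x y.

Definition W (e x : nat) : Prop := exists y, phi e x y.

Definition ce (X : nat -> Prop) : Prop :=
  exists e, forall x, X x <-> W e x.

Definition computable_fun (f : nat -> nat) : Prop :=
  exists e, forall x, phi e x (f x).

Definition computable_set (X : pred nat) : Prop :=
  computable_fun (fun x => X x : nat).

(* The symbols are their indices.  Since the two index sets are disjoint, one
   arity function serves for both; its values at other numbers are irrelevant. *)
Record language := Language {
  rel_index : pred nat;
  fun_index : pred nat;
  arity : nat -> nat;
  index_disjoint : forall n, ~~ (rel_index n && fun_index n);
  rel_index_computable : computable_set rel_index;
  fun_index_computable : computable_set fun_index;
  arity_computable : computable_fun arity;
  rel_arity_pos : forall n, rel_index n -> 0 < arity n
}.

Definition rel_symbol (L : language) := {n : nat | rel_index L n}.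
Definition fun_symbol (L : language) := {n : nat | fun_index L n}.

Definition rar (L : language) (r : rel_symbol L) : nat := arity L (sval r).
Definition far (L : language) (f : fun_symbol L) : nat := arity L (sval f).

(* The empty structure is allowed when the language has no constants. *)
Record interp (L : language) (T : Type) := Interp {
  rel_of : forall r : rel_symbol L, (rar r).-tuple T -> Prop;
  fun_of : forall f : fun_symbol L, (far f).-tuple T -> T
}.

Record structure (L : language) := Structure {
  carrier :> Type;
  interp_of : interp L carrier
}.

Definition rel_holds (L : language) (A : structure L) (r : rel_symbol L)
  (a : (rar r).-tuple A) : Prop := rel_of (interp_of A) a.

Definition fun_val (L : language) (A : structure L) (f : fun_symbol L)
  (a : (far f).-tuple A) : A := fun_of (interp_of A) a.

Definition is_iso (L : language) (A B : structure L) (h : A -> B) : Prop :=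
  [/\ bijective h,
      forall (r : rel_symbol L) (a : (rar r).-tuple A),
        rel_holds a <-> rel_holds (map_tuple h a)
    & forall (f : fun_symbol L) (a : (far f).-tuple A),
        h (fun_val a) = fun_val (map_tuple h a)].

Definition isomorphic (L : language) (A B : structure L) : Prop :=
  exists h : A -> B, is_iso h.

Definition fun_closed (L : language) (A : structure L) (P : A -> Prop) : Prop :=
  forall (f : fun_symbol L) (a : (far f).-tuple A),
    (forall i, P (tnth a i)) -> P (fun_val a).

Lemma fun_closed_sig (L : language) (A : structure L) (P : A -> Prop)
  (cP : fun_closed P) (f : fun_symbol L) (a : (far f).-tuple {x : A | P x}) :
  P (fun_val (map_tuple sval a)).
Proof. by apply: cP => i; rewrite tnth_map; exact: svalP. Qed.

Definition substructure (L : language) (A : structure L) (P : A -> Prop)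
    (cP : fun_closed P) : structure L :=
  @Structure L {x : A | P x}
    (@Interp L {x : A | P x}
       (fun r a => rel_holds (map_tuple sval a))
       (fun f a => exist P _ (fun_closed_sig cP a))).

(* The underlying set of the smallest substructure containing a. *)
Definition cl (L : language) (A : structure L) (n : nat) (a : n.-tuple A)
    (x : A) : Prop :=
  forall P : A -> Prop, fun_closed P -> (forall i, P (tnth a i)) -> P x.

Definition generates (L : language) (A : structure L) (n : nat)
  (a : n.-tuple A) : Prop := forall x : A, cl a x.

Definition fin_gen (L : language) (A : structure L) : Prop :=
  exists n (a : n.-tuple A), generates a.

Inductive term (L : language) (n : nat) : Type :=
| Var of 'I_n
| App (f : fun_symbol L) of ('I_(far f) -> term L n).

Inductive atomic (L : language) (n : nat) : Type :=
| EqF of term L n & term L n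
| RelF (r : rel_symbol L) of ('I_(rar r) -> term L n).

Fixpoint term_val (L : language) (A : structure L) (n : nat) (a : n.-tuple A)
    (t : term L n) : A :=
  match t with
  | Var i => tnth a i
  | App f ts => fun_val [tuple term_val a (ts i) | i < far f]
  end.

Definition sat (L : language) (A : structure L) (n : nat) (a : n.-tuple A)
    (phi : atomic L n) : Prop :=
  match phi with
  | EqF s t => term_val a s = term_val a t
  | RelF r ts => rel_holds [tuple term_val a (ts i) | i < rar r]
  end.

(* Tuples of different lengths are never related. *)
Definition simeq (L : language) (A B : structure L) (n m : nat)
    (a : n.-tuple A) (b : m.-tuple B) : Prop :=
  exists e : m = n, forall phi : atomic L n, sat a phi <-> sat (tcast e b) phi.

Record nat_structure (L : language) := NatStructure {
  dom : pred nat;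
  nat_interp : interp L {x : nat | dom x}
}.

Coercion structure_of (L : language) (A : nat_structure L) : structure L :=
  Structure (nat_interp A).

Definition elt_code (L : language) (A : nat_structure L) (x : A) : nat := sval x.

Definition tuple_code (L : language) (A : nat_structure L) (n : nat)
  (a : n.-tuple A) : nat := CodeSeq.code (map (@elt_code L A) a).

Definition rel_graph (L : language) (A : nat_structure L) (z : nat) : Prop :=
  exists (r : rel_symbol L) (a : (rar r).-tuple A),
    rel_holds a /\ z = cpair (sval r) (tuple_code a).

Definition nrel_graph (L : language) (A : nat_structure L) (z : nat) : Prop :=
  exists (r : rel_symbol L) (a : (rar r).-tuple A),
    ~ rel_holds a /\ z = cpair (sval r) (tuple_code a).

Definition fun_graph (L : language) (A : nat_structure L) (z : nat) : Prop :=
  exists (f : fun_symbol L) (a : (far f).-tuple A),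
    z = cpair (sval f) (cpair (tuple_code a) (elt_code (fun_val a))).

(* An index of a computable structure packs an index of the characteristic
   function of its underlying set with c.e. indices of the three graphs. *)
Definition structure_index (L : language) (A : nat_structure L) (e : nat) : Prop :=
  exists d p n f : nat,
    [/\ e = cpair d (cpair p (cpair n f)),
        forall x, phi d x (dom A x),
        forall z, rel_graph A z <-> W p z,
        forall z, nrel_graph A z <-> W n z
      & forall z, fun_graph A z <-> W f z].

Definition age (L : language) (K : structure L -> Prop) : Prop :=
  (forall A, K A -> fin_gen A) /\
  (forall A B, K A -> isomorphic A B -> K B).

(* As every member of an age is finitely generated, only the finitely
   generated substructures are asked to be in K. *)
Definition HP (L : language) (K : structure L -> Prop) : Prop :=
  forall (B : structure L) (P : B -> Prop) (cP : fun_closed P),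
    K B -> fin_gen (substructure cP) -> K (substructure cP).

Definition triple_code (L : language) (A : nat_structure L) (n : nat)
  (a : n.-tuple A) (e i : nat) : nat := cpair (tuple_code a) (cpair e i).

(* The set of triples is the range of the sequence of the (gen i, str i, i).

   The members of an age are represented as structures with a distinguished
   generating tuple, so [represents] asks that every member B of K, with any
   tuple b generating it, be isomorphic to some (str i, gen i).  Matching B up
   to isomorphism without matching b would not suffice to find a gen j that is
   [simeq] to a given tuple: in the empty language, the sets with
   at most 2 elements are then represented by the triples
   ((), {}), ((0), {0}), ((0,1,0), {0,1}), ((0,1,0), {0,1}) and so on,
   and no gen j is [simeq] to the tuple (0,1).  An age represented in the weak
   sense is also represented in this one: list the (b, str i, i) for all b
   generating str i. *)
Record computable_age (L : language) (K : structure L -> Prop) := ComputableAge {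
  K_age : age K;
  str : nat -> nat_structure L;
  len : nat -> nat;
  gen : forall i, (len i).-tuple (str i);
  idx : nat -> nat;
  idxP : forall i, structure_index (str i) (idx i);
  str_in : forall i, K (str i);
  gen_generates : forall i, generates (gen i);
  represents : forall (B : structure L) (n : nat) (b : n.-tuple B),
    K B -> generates b ->
    exists (i : nat) (h : B -> str i),
      is_iso h /\ map h b = gen i :> seq (str i);
  triples_ce : ce (fun z => exists i, z = triple_code (gen i) (idx i) i)
}.

Definition triple (L : language) (K : structure L -> Prop)
    (KK : computable_age K) (i : nat) : nat :=
  triple_code (gen KK i) (idx KK i) i.

Definition embedding_info (L : language) (K : structure L -> Prop)
    (KK : computable_age K) (z : nat) : Prop :=
  exists (k0 k1 n0 n1 : nat)
    (b0 : n0.-tuple (str KK k0)) (b1 : n1.-tuple (str KK k1)),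
    simeq b0 b1 /\
    z = cpair (cpair (triple KK k0) (tuple_code b0))
              (cpair (triple KK k1) (tuple_code b1)).

(* p computes, from the oracle O, a function sending each (triple i, b) to some
   triple j with gen j simeq b. *)
Definition computable_HP (L : language) (K : structure L -> Prop)
    (KK : computable_age K) (O : nat -> Prop) : Prop :=
  exists p : prog,
    forall (i n : nat) (b : n.-tuple (str KK i)),
      exists j : nat,
        eval O p (cpair (triple KK i) (tuple_code b)) (triple KK j) /\
        simeq (gen KK j) b.

(* Main.v *)
Require Import Defs.
From Stdlib Require Import Classical.
From Stdlib Require Cantor.
From mathcomp Require Import all_boot.

(* A triple w = (a_j, A_j, j) with a_j simeq b is found by unbounded search
   through all numbers w, asking the oracle for ((w, first component of w),
   (I(i), b)).  A positive answer already forces w to be a triple of the age and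
   its first component to code a_j, so the triples need not be enumerated.  The
   search succeeds because cl(b) belongs to K by (HP). *)

Set Implicit Arguments.
Unset Strict Implicit.
Unset Printing Implicit Defensive.

Lemma cfst_pair (x y : nat) : cfst (cpair x y) = x.
Proof. by rewrite /cfst /cpair Cantor.cancel_of_to. Qed.

Lemma csnd_pair (x y : nat) : csnd (cpair x y) = y.
Proof. by rewrite /csnd /cpair Cantor.cancel_of_to. Qed.

Lemma cpair_inj (x y x' y' : nat) :
  cpair x y = cpair x' y' -> x = x' /\ y = y'.
Proof.
move=> e; split.
- by rewrite -(cfst_pair x y) e cfst_pair.
- by rewrite -(csnd_pair x y) e csnd_pair.
Qed.

(** Unbounded search halts at the least witness. The predicate is a [Prop] with no decision
    procedure, so strong induction splits cases classically. *)
Lemma ex_minimal (P : nat -> Prop) :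
  (exists n, P n) -> exists n, P n /\ (forall m, m < n -> ~ P m).
Proof.
case=> n; elim/ltn_ind: n => n IH Pn.
case: (classic (exists2 m, m < n & P m)) => [[m /IH]|H]; first exact.
by exists n; split=> // m lt_mn Pm; apply: H; exists m.
Qed.

Section Embedding.
Variable L : language.

(** Common generalization of isomorphisms and of inclusions of substructures. *)
Definition embedding (A B : structure L) (h : A -> B) : Prop :=
  [/\ injective h,
      forall (r : rel_symbol L) (a : (rar r).-tuple A),
        rel_holds a <-> rel_holds (map_tuple h a)
    & forall (f : fun_symbol L) (a : (far f).-tuple A),
        h (fun_val a) = fun_val (map_tuple h a)].

Lemma iso_embedding (A B : structure L) (h : A -> B) :
  is_iso h -> embedding h.
Proof. by case=> /bij_inj. Qed.

Lemma sval_embedding (A : structure L) (P : A -> Prop) (cP : fun_closed P) :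
  @embedding (substructure cP) A sval.
Proof.
split=> //= -[x Px] [y Py] /= exy.
by case: y / exy Py => Py; rewrite (proof_irrelevance _ Px Py).
Qed.

Lemma term_val_embedding (A B : structure L) (h : A -> B) (n : nat)
  (a : n.-tuple A) (t : term L n) :
  embedding h -> term_val (map_tuple h a) t = h (term_val a t).
Proof.
move=> [_ _ hF]; elim: t => [i|f ts IH] /=; first by rewrite tnth_map.
rewrite hF; congr fun_val; apply: eq_from_tnth => i.
by rewrite tnth_mktuple IH tnth_map tnth_mktuple.
Qed.

Lemma sat_embedding (A B : structure L) (h : A -> B) (n : nat)
  (a : n.-tuple A) (phi : atomic L n) :
  embedding h -> sat (map_tuple h a) phi <-> sat a phi.
Proof.
move=> emb; case: phi => [s t|r ts] /=; case: (emb) => hI hR _.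
  by rewrite !term_val_embedding //; split=> [/hI|->].
rewrite hR.
suff -> : [tuple term_val (map_tuple h a) (ts i) | i < rar r] =
          map_tuple h [tuple term_val a (ts i) | i < rar r] by [].
apply: eq_from_tnth => i.
by rewrite tnth_mktuple term_val_embedding // tnth_map tnth_mktuple.
Qed.

(** Embeddings preserve and reflect atomic formulas, so both images satisfy the same ones as [c].
    Equating sequences rather than tuples leaves the lengths free; they are unified inside the
    proof. *)
Lemma simeq_embeddings (A B C : structure L) (f : C -> A) (g : C -> B)
  (n m k : nat) (c : n.-tuple C) (a : m.-tuple A) (b : k.-tuple B) :
  embedding f -> embedding g ->
  map f c = a :> seq A -> map g c = b :> seq B -> simeq a b.
Proof.
move=> ef eg fc gc.
have em : n = m by rewrite -(size_tuple a) -fc size_map size_tuple.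
have ek : n = k by rewrite -(size_tuple b) -gc size_map size_tuple.
case: m / em a fc => a fc; case: k / ek b gc => b gc.
have -> : a = map_tuple f c by exact: val_inj.
have -> : b = map_tuple g c by exact: val_inj.
by exists erefl => phi; rewrite tcast_id !sat_embedding.
Qed.

Lemma simeq_seq (A B : structure L) (n m n' m' : nat) (a : n.-tuple A)
  (b : m.-tuple B) (a' : n'.-tuple A) (b' : m'.-tuple B) :
  a = a' :> seq A -> b = b' :> seq B -> simeq a b -> simeq a' b'.
Proof.
move=> ea eb.
have en : n = n' by rewrite -(size_tuple a) ea size_tuple.
have em : m = m' by rewrite -(size_tuple b) eb size_tuple.
case: n' / en a' ea => a' /val_inj <-.
by case: m' / em b' eb => b' /val_inj <-.
Qed.

Lemma cl_closed (A : structure L) (n : nat) (a : n.-tuple A) :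
  fun_closed (cl a).
Proof. by move=> f b clb P cP Pa; apply: (cP) => i; exact: clb i P cP Pa. Qed.

Lemma cl_tnth (A : structure L) (n : nat) (a : n.-tuple A) (i : 'I_n) :
  cl a (tnth a i).
Proof. by move=> P _. Qed.

Definition cl_gen (A : structure L) (n : nat) (a : n.-tuple A) :
  n.-tuple (substructure (cl_closed (a := a))) :=
  [tuple exist (cl a) _ (@cl_tnth A n a i) | i < n].

Lemma map_sval_cl_gen (A : structure L) (n : nat) (a : n.-tuple A) :
  map sval (cl_gen a) = a :> seq A.
Proof.
suff: map_tuple sval (cl_gen a) = a by move/(congr1 val).
by apply: eq_from_tnth => i; rewrite tnth_map tnth_mktuple.
Qed.

Lemma cl_gen_generates (A : structure L) (n : nat) (a : n.-tuple A) :
  generates (cl_gen a).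
Proof.
case=> x clx P cP Pa.
(* Minimality of [cl a] speaks of predicates on [A], so [P] is first pushed forward along the
   inclusion. *)
have [|i|clx' Px] := clx (fun y => exists cy : cl a y, P (exist _ y cy)).
- move=> f b Pb.
  (* Lift [b] to the substructure, with the membership proofs for which [P] is known. *)
  pose b' : (far f).-tuple (substructure (cl_closed (a := a))) :=
    [tuple exist _ (tnth b i) (let: ex_intro cy _ := Pb i in cy) | i < far f].
  have eb : map_tuple sval b' = b.
    by apply: eq_from_tnth => i; rewrite tnth_map tnth_mktuple.
  have Pb' : P (fun_val b').
    by apply: cP => i; rewrite tnth_mktuple; case: (Pb i).
  rewrite -eb; exists (fun_closed_sig (cl_closed (a := a)) b'); exact: Pb'.
- by exists (@cl_tnth A n a i); have := Pa i; rewrite tnth_mktuple.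
- by rewrite (proof_irrelevance _ clx clx').
Qed.

Lemma tuple_code_inj (A : nat_structure L) (n m : nat)
  (a : n.-tuple A) (b : m.-tuple A) :
  tuple_code a = tuple_code b -> a = b :> seq A.
Proof.
move/(can_inj CodeSeq.codeK); apply: inj_map => x y; exact: val_inj.
Qed.

Variables (K : structure L -> Prop) (KK : computable_age K).

Lemma triple_inj : injective (triple KK).
Proof. by move=> i j /cpair_inj[_ /cpair_inj[_]]. Qed.

(** The closure [C] of [b] embeds in [str KK i] by inclusion, and in some [str KK j] by an
    isomorphism carrying its generators to [gen KK j]. *)
Lemma exists_simeq_gen (i n : nat) (b : n.-tuple (str KK i)) :
  HP K -> exists j, simeq (gen KK j) b.
Proof.
move=> hpK; pose C := substructure (cl_closed (a := b)).
have KC : K C.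
  apply: hpK; first exact: str_in.
  by exists n, (cl_gen b); apply: cl_gen_generates.
have [j [h [iso_h hb]]] := represents KK KC (cl_gen_generates (a := b)).
exists j; apply: (simeq_embeddings (iso_embedding iso_h)) hb _.
  exact: sval_embedding.
exact: map_sval_cl_gen.
Qed.

Lemma embedding_info_genP (w i n : nat) (b : n.-tuple (str KK i)) :
  embedding_info KK
    (cpair (cpair w (cfst w)) (cpair (triple KK i) (tuple_code b))) <->
  exists2 j, w = triple KK j & simeq (gen KK j) b.
Proof.
split=> [[k0 [k1 [n0 [n1 [b0 [b1 [sb]]]]]]]|[j -> sb]]; last first.
  exists j, i, (len KK j), n, (gen KK j), b.
  by split=> //; rewrite /triple /triple_code cfst_pair.
case/cpair_inj=> /cpair_inj[-> e0] /cpair_inj[/triple_inj e1].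
(* Only once [k1] is identified with [i] do [b] and [b1] live in the same structure, where codes
   determine tuples. *)
case: k1 / e1 b1 sb => b1 sb /tuple_code_inj eb.
exists k0 => //; apply: simeq_seq sb => //.
by apply: tuple_code_inj; rewrite -e0 /triple /triple_code cfst_pair.
Qed.

End Embedding.

Definition query : prog := Pair (Pair Snd (Comp Fst Snd)) Fst.

(* PrimRec turns the answer 1 into 0, on which Mu stops, and 0 into 1. *)
Definition search : prog :=
  Mu (Comp (PrimRec (Comp Succ Zero) Zero) (Pair Zero (Comp Oracle query))).

Lemma eval_query O x w :
  eval O query (cpair x w) (cpair (cpair w (cfst w)) x).
Proof.
have eS : eval O Snd (cpair x w) w by rewrite -{2}(csnd_pair x w); constructor.
have eF : eval O Fst (cpair x w) x by rewrite -{2}(cfst_pair x w); constructor.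
apply: eval_pair eF; apply: eval_pair (eS) _.
by apply: eval_comp eS _; constructor.
Qed.

Lemma eval_search O x w :
  O (cpair (cpair w (cfst w)) x) ->
  (forall v, v < w -> ~ O (cpair (cpair v (cfst v)) x)) ->
  eval O search x w.
Proof.
(* Used twice: as the nonzero value at rejected candidates, and as the preceding value that the
   recursion needs at argument 1. *)
have flip0 : eval O (PrimRec (Comp Succ Zero) Zero) (cpair 0 0) 1.
  by apply: eval_rec0; apply: eval_comp; constructor.
move=> Ow Nv; apply: eval_mu => [|v /Nv NOv].
  apply: eval_comp (_ : eval O _ _ (cpair 0 1)) _.
    apply: eval_pair; first exact: eval_zero.
    exact: eval_comp (eval_query _ _ _) (eval_oracle_in Ow).
  by apply: eval_recS flip0 _; constructor.
exists 0; apply: eval_comp flip0.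
apply: eval_pair; first exact: eval_zero.
exact: eval_comp (eval_query _ _ _) (eval_oracle_out NOv).
Qed.

Theorem lemma5p17 :
  forall (L : language) (K : structure L -> Prop) (KK : computable_age K),
    HP K -> computable_HP KK (embedding_info KK).
Proof.
move=> L K KK hpK; exists search => i n b.
pose Q w := embedding_info KK
  (cpair (cpair w (cfst w)) (cpair (triple KK i) (tuple_code b))).
have [w [Qw minw]] : exists w, Q w /\ (forall v, v < w -> ~ Q v).
  apply: ex_minimal; have [j sj] := exists_simeq_gen b hpK.
  by exists (triple KK j); apply/embedding_info_genP; exists j.
(* The least [w] may differ from the triple that showed the search succeeds, so its index is read
   off afresh. *)
have [j ew sj] := (embedding_info_genP w b).1 Qw.
by exists j; split=> //; rewrite -ew; apply: eval_search.
Qed.
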